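(* Let $R$ be a finite Lie conformal algebra which is free as a $\mathbb{C}[\partial]$-module. Then $r\in R\otimes R$ is a skew-symmetric and non-degenerate solution of the conformal classical Yang-Baxter equation in $R$ if and only if the bilinear form defined by $$\alpha_\lambda(a,b)=\{(T_0^r)^{-1}(a),b\}_\lambda=\big((T_0^r)^{-1}(a)\big)_\lambda(b),\qquad a,b\in R,$$ is a 2-cocycle on $R$, where $T_0^r\in\mathrm{Chom}(R^{*c},R)$ is the element corresponding to $r$ through the isomorphism $R\otimes R\cong\mathrm{Chom}(R^{*c},R)$.
   Context: A Lie conformal algebra is a $\mathbb{C}[\partial]$-module $R$ with a $\mathbb{C}$-bilinear map $R\times R\to R[\lambda]$, $(a,b)\mapsto[a_\lambda b]$, such that $[\partial a_\lambda b]=-\lambda[a_\lambda b]$, $[a_\lambda \partial b]=(\partial+\lambda)[a_\lambda b]$, $[a_\lambda b]=-[b_{-\lambda-\partial}a]$ (with $\partial$ acting on the coefficients) and $[a_\lambda[b_\mu c]]=[[a_\lambda b]_{\lambda+\mu}c]+[b_\mu[a_\lambda c]]$. It is finite if it is finitely generated as a $\mathbb{C}[\partial]$-module. All tensor products are over $\mathbb{C}$. For $\mathbb{C}[\partial]$-modules $U,V$, $\mathrm{Chom}(U,V)$ is the set of conformal linear maps, i.e. $\mathbb{C}$-linear maps $T_\lambda:U\to V[\lambda]$ with $T_\lambda(\partial u)=(\partial+\lambda)T_\lambda(u)$. The conformal dual $R^{*c}$ is the set of $\mathbb{C}$-linear maps $f_\lambda:R\to\mathbb{C}[\lambda]$ with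 $f_\lambda(\partial a)=\lambda f_\lambda(a)$, a $\mathbb{C}[\partial]$-module by $(\partial f)_\lambda=-\lambda f_\lambda$. For $f,g\in R^{*c}$ and $a,b\in R$ write $\{f,a\}_\lambda=f_\lambda(a)$ and $\{f\otimes g,a\otimes b\}_{(\lambda,\mu)}=\{f,a\}_\lambda\{g,b\}_\mu$. For $r=\sum_i a_i\otimes b_i\in R\otimes R$: $r^{21}=\sum_i b_i\otimes a_i$, and $r$ is skew-symmetric if $r=-r^{21}$. Under the isomorphism $R\otimes R\cong\mathrm{Chom}(R^{*c},R)$, $r$ corresponds to the conformal linear map $T^r$ determined by $\{f,T^r_{-\mu-\partial}(g)\}_\lambda=\{g\otimes f,r\}_{(\mu,\lambda)}$ for $f,g\in R^{*c}$, that is, $T^r_\lambda(u)=\sum_i\{u,a_i\}_{-\lambda-\partial}\,b_i$ for $u\in R^{*c}$ (the polynomial $u_x(a_i)$ is evaluated at $x=-\lambda-\partial$, with $\partial$ acting on $b_i$). Put $T_0^r=T^r_\lambda|_{\lambda=0}$. The element $r$ is called non-degenerate if $T^r_\lambda=T^r_0$ is a $\mathbb{C}[\partial]$-module isomorphism from $R^{*c}$ to $R$; in this case the relation between $r$ and $T_0^r$ reads $\{f,T_0^r(g)\}_\lambda=\{g\otimes f,r\}_{(-\lambda,\lambda)}$ for $f,g\in R^{*c}$. A 2-cocycle of $R$ is a $\mathbb{C}$-linear map $\alpha_\lambda:R\otimes R\to\mathbb{C}[\lambda]$ such that for all $a,b,c\in R$: $\alpha_\lambda(\partial a,b)=-\lambda\alpha_\lambda(a,b)$,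 $\alpha_\lambda(a,\partial b)=\lambda\alpha_\lambda(a,b)$, $\alpha_\lambda(a,b)=-\alpha_{-\lambda}(b,a)$, and $\alpha_\lambda(a,[b_\mu c])-\alpha_\mu(b,[a_\lambda c])=\alpha_{\lambda+\mu}([a_\lambda b],c)$. The conformal classical Yang-Baxter equation for $r=\sum_i a_i\otimes b_i$ in $R$ is $$\sum_{i,j}\big([{a_i}_\mu a_j]\otimes b_i\otimes b_j|_{\mu=1\otimes\partial\otimes1}-a_i\otimes[{a_j}_\mu b_i]\otimes b_j|_{\mu=1\otimes1\otimes\partial}-a_i\otimes a_j\otimes[{b_j}_\mu b_i]|_{\mu=1\otimes\partial\otimes1}\big)=0 \mod (\partial^{\otimes^3})$$ in $R\otimes R\otimes R$, where $\partial^{\otimes^3}=\partial\otimes1\otimes1+1\otimes\partial\otimes1+1\otimes1\otimes\partial$, ''mod $(\partial^{\otimes^3})$'' means modulo $\partial^{\otimes^3}(R\otimes R\otimes R)$, and the subscript means each power $\mu^n$ is replaced by the $n$-th power of the indicated operator.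
   Formalization: If the form is a 2-cocycle, r is skew-symmetric only modulo (∂⊗1+1⊗∂)(R⊗R), as T_0^r determines r only up to this; for exactly skew r the equivalence is kept. Non-degenerate means T_0^r is an isomorphism; the condition T_λ^r=T_0^r, which forces R=0, is dropped. *)

(* Defs.v *)
From HB Require Import structures.
From mathcomp Require Import all_boot all_order all_algebra.
From mathcomp Require Import finmap boolp reals complex.

Set Implicit Arguments.
Unset Strict Implicit.
Unset Printing Implicit Defensive.

Import GRing.Theory Num.Theory.
Local Open Scope ring_scope.

(* A C[∂]-module is an lmodType over {poly C}: ∂ acts as 'X and a scalar c as  *)
(* c%:P. The same type {poly C} also plays the role of C[λ]; the two uses are  *)
(* told apart by *: (action of C[∂]) and * (product in C[λ]).                  *)

Definition finite_module (C : numClosedFieldType) (R : lmodType {poly C}) : Prop :=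
  exists (n : nat) (e : 'I_n -> R), forall a : R,
    exists c : 'I_n -> {poly C}, a = \sum_(i < n) c i *: e i.

Definition free_module (C : numClosedFieldType) (R : lmodType {poly C}) : Prop :=
  exists (I : choiceType) (e : I -> R),
    (forall a : R, exists (s : seq I) (c : I -> {poly C}),
       a = \sum_(i <- s) c i *: e i) /\
    (forall (s : seq I) (c : I -> {poly C}), uniq s ->
       \sum_(i <- s) c i *: e i = 0 -> forall i, i \in s -> c i = 0).

(* R[λ]: p stands for the polynomial \sum_n λ^n p n. *)
Definition vpoly (C : numClosedFieldType) (R : lmodType {poly C}) : Type :=
  {fsfun nat -> R with 0}.

(* Substitution of an operator q(∂) for λ, acting on the coefficients; q = x%:P *)
(* is evaluation at the scalar x.                                              *)
Definition veval (C : numClosedFieldType) (R : lmodType {poly C})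
    (p : vpoly R) (q : {poly C}) : R :=
  \sum_(n <- finsupp p) q ^+ n *: p n.

(* C being infinite, identities in R[λ] and R[λ, μ] are stated as equalities   *)
(* of values at all scalars x (for λ) and y (for μ).                           *)
Record lieConformal (C : numClosedFieldType) (R : lmodType {poly C}) := {
  lbr : R -> R -> vpoly R;
  lbr_linearl : forall (c : C) (a a' b : R) (n : nat),
    lbr (c%:P *: a + a') b n = c%:P *: lbr a b n + lbr a' b n;
  lbr_linearr : forall (c : C) (a b b' : R) (n : nat),
    lbr a (c%:P *: b + b') n = c%:P *: lbr a b n + lbr a b' n;
  lbr_derl : forall (a b : R) (x : C),
    veval (lbr ('X *: a) b) x%:P = - (x%:P *: veval (lbr a b) x%:P);
  lbr_derr : forall (a b : R) (x : C),
    veval (lbr a ('X *: b)) x%:P = ('X + x%:P) *: veval (lbr a b) x%:P;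
  lbr_skew : forall (a b : R) (x : C),
    veval (lbr a b) x%:P = - veval (lbr b a) (- x%:P - 'X);
  lbr_jacobi : forall (a b c : R) (x y : C),
    veval (lbr a (veval (lbr b c) y%:P)) x%:P =
      veval (lbr (veval (lbr a b) x%:P) c) (x + y)%:P +
      veval (lbr b (veval (lbr a c) x%:P)) y%:P
}.

(* The conformal dual R^{*c}, with its C[∂]-module structure below. *)
Record cdual (C : numClosedFieldType) (R : lmodType {poly C}) := CDual {
  cdual_fun :> R -> {poly C};
  cdual_linear : forall (c : C) (a b : R),
    cdual_fun (c%:P *: a + b) = c%:P * cdual_fun a + cdual_fun b;
  cdual_der : forall a : R, cdual_fun ('X *: a) = 'X * cdual_fun a
}.

Section ConformalDual.
Context {C : numClosedFieldType} {R : lmodType {poly C}}.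
Implicit Types f g : cdual R.

Lemma cdualP f g : (forall a, f a = g a) -> f = g.
Proof.
case: f g => [f f1 f2] [g g1 g2] /= /funext fg; subst g.
by rewrite (Prop_irrelevance f1 g1) (Prop_irrelevance f2 g2).
Qed.

Fact cdual0_linear (c : C) (a b : R) : 0 = c%:P * 0 + 0 :> {poly C}.
Proof. by rewrite mulr0 addr0. Qed.
Fact cdual0_der (a : R) : 0 = 'X * 0 :> {poly C}.
Proof. by rewrite mulr0. Qed.
Definition cdual0 : cdual R :=
  @CDual C R (fun=> 0) cdual0_linear cdual0_der.

Fact cdualD_linear f g (c : C) (a b : R) :
  f (c%:P *: a + b) + g (c%:P *: a + b) = c%:P * (f a + g a) + (f b + g b).
Proof. by rewrite !cdual_linear mulrDr addrACA. Qed.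
Fact cdualD_der f g (a : R) : f ('X *: a) + g ('X *: a) = 'X * (f a + g a).
Proof. by rewrite !cdual_der mulrDr. Qed.
Definition cdualD f g : cdual R :=
  @CDual C R (fun a => f a + g a) (cdualD_linear f g) (cdualD_der f g).

Fact cdualM_linear (p : {poly C}) f (c : C) (a b : R) :
  p * f (c%:P *: a + b) = c%:P * (p * f a) + p * f b.
Proof. by rewrite cdual_linear mulrDr mulrCA. Qed.
Fact cdualM_der (p : {poly C}) f (a : R) : p * f ('X *: a) = 'X * (p * f a).
Proof. by rewrite cdual_der mulrCA. Qed.
Definition cdualM (p : {poly C}) f : cdual R :=
  @CDual C R (fun a => p * f a) (cdualM_linear p f) (cdualM_der p f).

HB.instance Definition _ := gen_eqMixin (cdual R).
HB.instance Definition _ := gen_choiceMixin (cdual R).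

Fact cdualDA : associative cdualD.
Proof. by move=> f g h; apply: cdualP => a /=; rewrite addrA. Qed.
Fact cdualDC : commutative cdualD.
Proof. by move=> f g; apply: cdualP => a /=; rewrite addrC. Qed.
Fact cdual0D : left_id cdual0 cdualD.
Proof. by move=> f; apply: cdualP => a /=; rewrite add0r. Qed.
Fact cdualND : left_inverse cdual0 (cdualM (-1)) cdualD.
Proof. by move=> f; apply: cdualP => a /=; rewrite mulN1r addNr. Qed.

HB.instance Definition _ :=
  GRing.isZmodule.Build (cdual R) cdualDA cdualDC cdual0D cdualND.

(* As ∂ acts on R^{*c} by -λ, p(∂) acts by p(-λ). *)
Definition cdualZ (p : {poly C}) f : cdual R := cdualM (p \Po - 'X) f.

Fact cdualZA (p q : {poly C}) f : cdualZ p (cdualZ q f) = cdualZ (p * q) f.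
Proof. by apply: cdualP => a /=; rewrite mulrA comp_polyM. Qed.
Fact cdual1Z : left_id 1 cdualZ.
Proof. by move=> f; apply: cdualP => a /=; rewrite comp_polyC mul1r. Qed.
Fact cdualZDr : right_distributive cdualZ +%R.
Proof. by move=> p f g; apply: cdualP => a /=; rewrite mulrDr. Qed.
Fact cdualZDl f : {morph cdualZ^~ f : p q / p + q}.
Proof. by move=> p q; apply: cdualP => a /=; rewrite comp_polyD mulrDl. Qed.

HB.instance Definition _ :=
  GRing.Zmodule_isLmodule.Build {poly C} (cdual R)
    cdualZA cdual1Z cdualZDr cdualZDl.

Lemma cdual_derE f (a : R) : ('X *: f) a = - ('X * f a).
Proof. by rewrite /= comp_polyX mulNr. Qed.

End ConformalDual.

(* Elements of the tensor products over C are presented by finite sums:        *)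
(* [:: (a_1, b_1); ...; (a_k, b_k)] stands for \sum_i a_i ⊗ b_i.               *)
Definition tensor2 (C : numClosedFieldType) (R : lmodType {poly C}) : Type := seq (R * R).
Definition tensor3 (C : numClosedFieldType) (R : lmodType {poly C}) : Type :=
  seq (R * R * R).

Definition Clinear (C : numClosedFieldType) (R : lmodType {poly C}) (W : lmodType C)
    (phi : R -> W) : Prop :=
  forall (c : C) (a b : R), phi (c%:P *: a + b) = c *: phi a + phi b.

(* Equality in R ⊗ R and R ⊗ R ⊗ R, by the universal property: two sums are    *)
(* equal iff all C-multilinear maps to C-vector spaces agree on them.          *)
Definition tensor2_eq (C : numClosedFieldType) (R : lmodType {poly C})
    (s t : tensor2 R) : Prop :=
  forall (W : lmodType C) (phi : R -> R -> W),
    (forall b, Clinear (fun a => phi a b)) -> (forall a, Clinear (phi a)) ->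
    \sum_(u <- s) phi u.1 u.2 = \sum_(u <- t) phi u.1 u.2.

Definition tensor3_eq (C : numClosedFieldType) (R : lmodType {poly C})
    (s t : tensor3 R) : Prop :=
  forall (W : lmodType C) (phi : R -> R -> R -> W),
    (forall b c, Clinear (fun a => phi a b c)) ->
    (forall a c, Clinear (fun b => phi a b c)) ->
    (forall a b, Clinear (phi a b)) ->
    \sum_(u <- s) phi u.1.1 u.1.2 u.2 = \sum_(u <- t) phi u.1.1 u.1.2 u.2.

Definition tensor2_opp (C : numClosedFieldType) (R : lmodType {poly C})
    (s : tensor2 R) : tensor2 R := [seq (- u.1, u.2) | u <- s].

Definition tensor3_opp (C : numClosedFieldType) (R : lmodType {poly C})
    (s : tensor3 R) : tensor3 R := [seq (- u.1.1, u.1.2, u.2) | u <- s].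

Definition tensor2_flip (C : numClosedFieldType) (R : lmodType {poly C})
    (s : tensor2 R) : tensor2 R := [seq (u.2, u.1) | u <- s].

(* ∂ ⊗ 1 + 1 ⊗ ∂ *)
Definition tensor2_der (C : numClosedFieldType) (R : lmodType {poly C})
    (s : tensor2 R) : tensor2 R :=
  [seq ('X *: u.1, u.2) | u <- s] ++ [seq (u.1, 'X *: u.2) | u <- s].

(* ∂ ⊗ 1 ⊗ 1 + 1 ⊗ ∂ ⊗ 1 + 1 ⊗ 1 ⊗ ∂ *)
Definition tensor3_der (C : numClosedFieldType) (R : lmodType {poly C})
    (s : tensor3 R) : tensor3 R :=
  [seq ('X *: u.1.1, u.1.2, u.2) | u <- s] ++
  [seq (u.1.1, 'X *: u.1.2, u.2) | u <- s] ++
  [seq (u.1.1, u.1.2, 'X *: u.2) | u <- s].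

Definition tensor2_skew (C : numClosedFieldType) (R : lmodType {poly C})
    (r : tensor2 R) : Prop :=
  tensor2_eq r (tensor2_opp (tensor2_flip r)).

(* r = - r^{21} modulo (∂ ⊗ 1 + 1 ⊗ ∂)(R ⊗ R). When R is finite and free, T^r_0 *)
(* determines r only modulo this subspace.                                     *)
Definition tensor2_skew_mod (C : numClosedFieldType) (R : lmodType {poly C})
    (r : tensor2 R) : Prop :=
  exists s : tensor2 R, tensor2_eq (r ++ tensor2_flip r) (tensor2_der s).

(* The value at λ = x of T^r_λ(u) = \sum_i {u, a_i}_{-λ-∂} b_i. *)
Definition Tmap (C : numClosedFieldType) (R : lmodType {poly C})
    (r : tensor2 R) (x : C) (u : cdual R) : R :=
  \sum_(p <- r) (u p.1 \Po (- x%:P - 'X)) *: p.2.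

Definition T0 (C : numClosedFieldType) (R : lmodType {poly C})
    (r : tensor2 R) : cdual R -> R := Tmap r 0.

(* T^r_0 is an isomorphism of C[∂]-modules. No condition is put on T^r_λ for   *)
(* λ <> 0: since T^r_λ (∂ u) = (∂ + λ) T^r_λ u, requiring T^r_λ = T^r_0 on all *)
(* of R^{*c} would force T^r = 0.                                              *)
Definition tensor2_nondegenerate (C : numClosedFieldType) (R : lmodType {poly C})
    (r : tensor2 R) : Prop :=
  linear (T0 r) /\ bijective (T0 r).

Section YangBaxter.
Context {C : numClosedFieldType} {R : lmodType {poly C}}.
Variables (L : lieConformal R) (r : tensor2 R).

(* \sum_{i,j} [a_i _μ a_j] ⊗ b_i ⊗ b_j  at  μ = 1 ⊗ ∂ ⊗ 1 *)
Definition cybe1 : tensor3 R :=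
  flatten [seq [seq (lbr L p.1 q.1 n, 'X^n *: p.2, q.2)
                 | n <- finsupp (lbr L p.1 q.1)] | p <- r, q <- r].

(* \sum_{i,j} a_i ⊗ [a_j _μ b_i] ⊗ b_j  at  μ = 1 ⊗ 1 ⊗ ∂ *)
Definition cybe2 : tensor3 R :=
  flatten [seq [seq (p.1, lbr L q.1 p.2 n, 'X^n *: q.2)
                 | n <- finsupp (lbr L q.1 p.2)] | p <- r, q <- r].

(* \sum_{i,j} a_i ⊗ a_j ⊗ [b_j _μ b_i]  at  μ = 1 ⊗ ∂ ⊗ 1 *)
Definition cybe3 : tensor3 R :=
  flatten [seq [seq (p.1, 'X^n *: q.1, lbr L q.2 p.2 n)
                 | n <- finsupp (lbr L q.2 p.2)] | p <- r, q <- r].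

Definition conformal_CYBE : Prop :=
  exists s : tensor3 R,
    tensor3_eq (cybe1 ++ tensor3_opp cybe2 ++ tensor3_opp cybe3)
               (tensor3_der s).

End YangBaxter.

Record two_cocycle (C : numClosedFieldType) (R : lmodType {poly C})
    (L : lieConformal R) (alpha : R -> R -> {poly C}) : Prop := {
  cocycle_linearl : forall (c : C) (a a' b : R),
    alpha (c%:P *: a + a') b = c *: alpha a b + alpha a' b;
  cocycle_linearr : forall (c : C) (a b b' : R),
    alpha a (c%:P *: b + b') = c *: alpha a b + alpha a b';
  cocycle_derl : forall a b : R, alpha ('X *: a) b = - ('X * alpha a b);
  cocycle_derr : forall a b : R, alpha a ('X *: b) = 'X * alpha a b;
  cocycle_skew : forall a b : R, alpha a b = - (alpha b a \Po (- 'X));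
  cocycle_jacobi : forall (a b c : R) (x y : C),
    (alpha a (veval (lbr L b c) y%:P)).[x] -
    (alpha b (veval (lbr L a c) x%:P)).[y] =
    (alpha (veval (lbr L a b) x%:P) c).[x + y]
}.

(* T^r_0 is invertible and α_λ(a, b) = {(T^r_0)^{-1}(a), b}_λ is a 2-cocycle. *)
Definition inverse_form_cocycle (C : numClosedFieldType)
    (R : lmodType {poly C}) (L : lieConformal R) (r : tensor2 R) : Prop :=
  exists S : R -> cdual R,
    [/\ cancel (T0 r) S, cancel S (T0 r)
      & two_cocycle L (fun a b => S a b)].

(* Main.v *)
Require Import Defs.
From HB Require Import structures.
From mathcomp Require Import all_boot all_order all_algebra.
From mathcomp Require Import finmap boolp reals complex.
From mathcomp Require Import ring.

(** The theorem is true because pairing the Yang-Baxter tensor with three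
    conformal functionals turns it into the cocycle identity, and because on a
    finite free module such pairings lose no information.

    Let T be T^r_0 and let f, g, h be in R^{*c}. Evaluating f ⊗ g ⊗ h at scalars
    (x, y, z) with x + y + z = 0 kills the image of ∂^{⊗3}. Sesquilinearity lets
    the three sums of the Yang-Baxter tensor be absorbed into the arguments of the
    brackets ([cdual_lbr_T0]), which gives ([cybe_eval])
      f([T'g _y T'h])(x) - g([T'h _z Tf])(y) - h([Tg _y Tf])(z),
    where T' is the operator of r^{21}. Skew-symmetry modulo ∂⊗1 + 1⊗∂ says
    exactly that T' = - T, that is, f(Tg)(x) = - g(Tf)(-x) ([tensor2_skew_modP]);
    written with a = Tf and b = Tg, this is the skew-symmetry of the form alpha.
    Using the skew-symmetry of the bracket, which at x + y + z = 0 exchanges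
    [a _x b] and - [b _y a] under evaluation at z, the expression becomes
      f([b _y c])(x) - g([a _x c])(y) + h([a _x b])(-x-y)
    with c = Th ([conformal_CYBEP]), and this is the defect of alpha in the
    cocycle identity. Bijectivity of T makes f, g, h range over all functionals
    exactly when a, b, c range over R.

    For the converse direction one must recover a tensor modulo the image of
    ∂^{⊗k} from its evaluations ([tensor2_der_eval], [tensor3_der_eval]). With a
    basis e_i of R, every power of ∂ on the last factor can be moved to the other
    factors, so each tensor is congruent to one of the form \sum_i t_i ⊗ e_i; the
    dual basis isolates t_i, whose evaluations are now unconstrained and hence
    determine it. *)

Set Implicit Arguments.
Unset Strict Implicit.
Unset Printing Implicit Defensive.

Import GRing.Theory Num.Theory.
Local Open Scope ring_scope.

(** * Conformal functionals and C-linear maps *)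

Section Functionals.
Context {C : numClosedFieldType} {R : lmodType {poly C}}.

Lemma cdual_is_additive (f : cdual R) : {morph f : a b / a + b}.
Proof. by move=> a b; have:= cdual_linear f 1 a b; rewrite scale1r mul1r. Qed.

(** Reading λ as ∂, the set R^{*c} is Hom(R, C[∂]) over C[∂]; only its module
    structure is twisted by λ -> -λ. *)
Lemma cdual_is_scalable (f : cdual R) (p : {poly C}) (a : R) :
  f (p *: a) = p * f a.
Proof.
have f0 : f 0 = 0.
  by apply: (addrI (f 0)); rewrite -cdual_is_additive !addr0.
elim/poly_ind: p a => [|p c IHp] a; first by rewrite scale0r mul0r.
rewrite scalerDl cdual_is_additive -scalerA IHp cdual_der mulrA mulrDl.
congr (_ + _).
by rewrite -[c%:P *: a]addr0 cdual_linear f0 addr0.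
Qed.

Fact cdual_linear_subproof (f : cdual R) : linear_for *%R f.
Proof. by move=> p a b; rewrite cdual_is_additive cdual_is_scalable. Qed.

HB.instance Definition _ (f : cdual R) :=
  GRing.isLinear.Build {poly C} R {poly C} _ (f : R -> _) (cdual_linear_subproof f).

Lemma poly_eq0_horner (p : {poly C}) : (forall x, p.[x] = 0) -> p = 0.
Proof.
move=> p0; apply/eqP; apply: contraT => pN0.
have := max_poly_roots (rs := [seq n%:R : C | n <- iota 0 (size p)]) pN0.
rewrite size_map size_iota ltnn; apply.
  by apply/allP => x _; rewrite rootE p0.
by rewrite map_inj_uniq ?iota_uniq // => m n /eqP; rewrite eqr_nat => /eqP.
Qed.

Lemma poly_eq_horner (p q : {poly C}) : (forall x, p.[x] = q.[x]) -> p = q.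
Proof.
move=> pq; apply/eqP; rewrite -subr_eq0; apply/eqP/poly_eq0_horner => x.
by rewrite hornerD hornerN pq subrr.
Qed.

Section Clinear.
Context (W : lmodType C) (phi : R -> W).
Context (phi_lin : Clinear phi).

Lemma ClinearD : {morph phi : a b / a + b}.
Proof. by move=> a b; have:= phi_lin 1 a b; rewrite !scale1r. Qed.
Lemma Clinear0 : phi 0 = 0.
Proof. by apply: (addrI (phi 0)); rewrite -ClinearD !addr0. Qed.
Lemma ClinearZ c a : phi (c%:P *: a) = c *: phi a.
Proof. by have:= phi_lin c a 0; rewrite Clinear0 !addr0. Qed.
Lemma ClinearN a : phi (- a) = - phi a.
Proof. by rewrite -scaleN1r -polyCN ClinearZ scaleN1r. Qed.
Lemma Clinear_sum (I : Type) (s : seq I) (F : I -> R) :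
  phi (\sum_(i <- s) F i) = \sum_(i <- s) phi (F i).
Proof. exact: (big_morph phi ClinearD Clinear0). Qed.
End Clinear.

End Functionals.

(** * Dual bases and the detection of tensors by evaluation *)

Definition dual_bases (C : numClosedFieldType) (R : lmodType {poly C}) (n : nat)
    (e : 'I_n -> R) (d : 'I_n -> cdual R) : Prop :=
  (forall a, a = \sum_i d i a *: e i) /\ (forall i j, d i (e j) = (i == j)%:R).

(** Each of the finitely many generators involves finitely many basis elements,
    so a finite part s of the basis spans; by independence the coordinates on s
    are unique, hence C[∂]-linear, hence conformal functionals. *)
Lemma finite_free_dual_bases (C : numClosedFieldType) (R : lmodType {poly C}) :
  finite_module R -> free_module R ->
  exists (n : nat) (e : 'I_n -> R) (d : 'I_n -> cdual R), dual_bases e d.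
Proof.
move=> [m [g ggen]] [I [e [egen efree]]].
have [supp suppP] : exists supp : 'I_m -> seq I, forall j, exists c : I -> {poly C},
    g j = \sum_(i <- supp j) c i *: e i.
  have [f fP] := choice (fun j => egen (g j)); by exists f.
pose s := undup (flatten [seq supp j | j <- enum 'I_m]).
pose inspan a := exists c : I -> {poly C}, a = \sum_(i <- s) c i *: e i.
have span0 : inspan 0.
  by exists (fun=> 0); rewrite big1 // => i _; rewrite scale0r.
have spanD a b : inspan a -> inspan b -> inspan (a + b).
  move=> [c ->] [c' ->]; exists (fun i => c i + c' i).
  by rewrite -big_split; apply: eq_bigr => i _; rewrite scalerDl.
have spanZ p a : inspan a -> inspan (p *: a).
  move=> [c ->]; exists (fun i => p * c i).
  by rewrite scaler_sumr; apply: eq_bigr => i _; rewrite scalerA.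
have spane i : i \in s -> inspan (e i).
  move=> si; exists (fun k => (k == i)%:R).
  rewrite (bigD1_seq i) ?undup_uniq //= eqxx scale1r big1 ?addr0 // => k /negPf ->.
  by rewrite scale0r.
have span_all a : inspan a.
  have [c ->] := ggen a; apply: big_ind => // j _; apply/spanZ.
  have [c' ->] := suppP j.
  rewrite big_seq; apply: big_ind => // i ji; apply/spanZ/spane.
  rewrite mem_undup; apply/flattenP; exists (supp j) => //.
  by apply: map_f; rewrite mem_enum.
have [coord coordP] := choice span_all.
have coord_uniq a c : a = \sum_(i <- s) c i *: e i ->
    forall i, i \in s -> coord a i = c i.
  move=> ac i si; apply/eqP; rewrite -subr_eq0; apply/eqP.
  apply: (efree s (fun i => coord a i - c i)) (undup_uniq _) _ i si.
  under eq_bigr do rewrite scalerBl.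
  by rewrite sumrB -coordP -ac subrr.
have coord_lin (p : {poly C}) a b i : i \in s ->
    coord (p *: a + b) i = p * coord a i + coord b i.
  apply: (coord_uniq _ (fun i => p * coord a i + coord b i)).
  rewrite {1}(coordP a) {1}(coordP b) scaler_sumr -big_split.
  by apply: eq_bigr => k _; rewrite scalerDl scalerA.
pose t := in_tuple s.
have coord_linC k (c : C) a b : coord (c%:P *: a + b) (tnth t k) =
    c%:P * coord a (tnth t k) + coord b (tnth t k).
  exact/coord_lin/mem_tnth.
have coord_der k a : coord ('X *: a) (tnth t k) = 'X * coord a (tnth t k).
  have c0 : coord 0 (tnth t k) = 0.
    apply: (coord_uniq 0 (fun=> 0)); last exact: mem_tnth.
    by rewrite big1 // => i _; rewrite scale0r.
  by rewrite -[_ *: a]addr0 coord_lin ?c0 ?addr0 // mem_tnth.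
exists (size s), (fun k => e (tnth t k)).
exists (fun k => CDual (coord_linC k) (coord_der k)); split=> [a|i j] /=.
  by rewrite [LHS]coordP [LHS]big_tnth.
rewrite -(inj_eq (tuple_uniqP t (undup_uniq _))).
apply: (coord_uniq _ (fun k => (k == tnth t j)%:R)); last exact: mem_tnth.
rewrite (bigD1_seq (tnth t j)) ?undup_uniq ?mem_tnth //= eqxx scale1r.
by rewrite big1 ?addr0 // => k /negPf ->; rewrite scale0r.
Qed.

Section Separation.
Context {C : numClosedFieldType} {R : lmodType {poly C}}.
Context (n : nat) (e : 'I_n -> R) (d : 'I_n -> cdual R).
Context (ed : dual_bases e d).

Lemma cdual_separates (a : R) : (forall f : cdual R, f a = 0) -> a = 0.
Proof. by move=> a0; rewrite [a](proj1 ed) big1 // => i _; rewrite a0 scale0r. Qed.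

Lemma Clinear_coord (W : lmodType C) (phi : R -> W) (phi_lin : Clinear phi) (a : R) N :
  (forall i, (size (d i a) <= N)%N) ->
  phi a = \sum_i \sum_(k < N) (d i a)`_k *: phi ('X^k *: e i).
Proof.
move=> szN; rewrite {1}[a](proj1 ed) (Clinear_sum phi_lin).
apply: eq_bigr => i _.
rewrite -{1}[d i a]coefK (poly_def (size _)) -(big_mkord xpredT (fun k => (d i a)`_k *: 'X^k)).
rewrite scaler_suml (Clinear_sum phi_lin).
rewrite -(big_mkord xpredT (fun k => (d i a)`_k *: phi ('X^k *: e i))).
rewrite (big_cat_nat (n := size (d i a)) _ (szN i)) //= [X in _ + X]big1_seq; last first.
  by move=> k; rewrite mem_index_iota => /andP[_ /andP[? _]]; rewrite nth_default ?scale0r.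
rewrite addr0; apply: eq_bigr => k _.
by rewrite -mul_polyC -scalerA (ClinearZ phi_lin).
Qed.

(** Expanding the second factors on the C-basis ∂^k e_i leaves one first factor
    for each pair (i, k); it is killed by all functionals because a polynomial in
    y with only zero values has zero coefficients. *)
Lemma tensor2_eval0 (t : seq (R * R)) :
  (forall (f g : cdual R) (x y : C),
     \sum_(u <- t) (f u.1).[x] * (g u.2).[y] = 0) ->
  tensor2_eq t [::].
Proof.
move=> t0 W phi phil phir; rewrite big_nil.
(* A common bound on the degrees gives all second factors the same index set. *)
pose N := \max_(u <- t) \max_i size (d i u.2).
have szN u i : u \in t -> (size (d i u.2) <= N)%N.
  move=> tu; apply: leq_trans (leq_bigmax_seq _ tu isT).
  exact: (leq_bigmax_cond (F := fun i => size (d i u.2))).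
rewrite big_seq.
under eq_bigr => u tu do rewrite (Clinear_coord (phir u.1) (fun i => szN u i tu)).
rewrite -big_seq exchange_big big1 //= => i _; rewrite exchange_big big1 //= => k _.
under eq_bigr do rewrite -(ClinearZ (phil _)).
rewrite -(Clinear_sum (phil _)).
rewrite [X in phi X _](_ : _ = 0) ?(Clinear0 (phil _)) //.
apply: cdual_separates => f; apply: poly_eq0_horner => x.
rewrite linear_sum /= horner_sum.
under eq_bigr do rewrite linearZ /= hornerM hornerC.
suff p0 : \sum_(u <- t) (f u.1).[x] *: d i u.2 = 0.
  move/(congr1 (fun p : {poly C} => p`_k)): p0; rewrite coef0 coef_sum => p0.
  by rewrite -[RHS]p0; apply: eq_bigr => u _; rewrite coefZ mulrC.
apply: poly_eq0_horner => y; rewrite -(t0 f (d i) x y) horner_sum.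
by apply: eq_bigr => u _; rewrite hornerZ.
Qed.

Lemma sum_tensor2_der (W : zmodType) (phi : R -> R -> W) (s : tensor2 R) :
  \sum_(u <- tensor2_der s) phi u.1 u.2 =
  \sum_(u <- s) (phi ('X *: u.1) u.2 + phi u.1 ('X *: u.2)).
Proof. by rewrite big_cat !big_map /= -big_split. Qed.

Lemma sum_tensor3_der (W : zmodType) (phi : R -> R -> R -> W) (s : tensor3 R) :
  \sum_(u <- tensor3_der s) phi u.1.1 u.1.2 u.2 =
  \sum_(u <- s) (phi ('X *: u.1.1) u.1.2 u.2 + phi u.1.1 ('X *: u.1.2) u.2
                 + phi u.1.1 u.1.2 ('X *: u.2)).
Proof. by rewrite !big_cat !big_map /= -!big_split; apply: eq_bigr => u _; rewrite /= addrA. Qed.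

(** Modulo ∂⊗1 + 1⊗∂ the operator 1⊗∂ is - ∂⊗1, so p(∂) on the second factor
    can be traded for p(-∂) on the first. Quantifying over phi after s and v makes
    this an identity of tensors. *)
Lemma tensor2_transfer (p : {poly C}) (a b : R) :
  exists (s : tensor2 R) (v : R), forall (W : lmodType C) (phi : R -> R -> W),
    (forall b, Clinear (fun a => phi a b)) -> (forall a, Clinear (phi a)) ->
    phi a (p *: b) = \sum_(u <- tensor2_der s) phi u.1 u.2 + phi v b.
Proof.
elim/poly_ind: p a => [|p c IHp] a.
  exists [::], 0 => W phi phil phir.
  by rewrite sum_tensor2_der big_nil scale0r (Clinear0 (phil b)) (Clinear0 (phir a)) addr0.
have [s [v sv]] := IHp (- ('X *: a)).
(* From a ⊗ ∂w = (∂⊗1 + 1⊗∂)(a ⊗ w) - ∂a ⊗ w with w = p b. *)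
exists ((a, p *: b) :: s), (v + c%:P *: a) => W phi phil phir.
have := sv W phi phil phir; rewrite !sum_tensor2_der big_cons /=.
rewrite (ClinearD (phil b)) (ClinearN (phil _)) (ClinearZ (phil b)).
rewrite mulrC scalerDl -scalerA (ClinearD (phir a)) (ClinearZ (phir a)) => IH.
by rewrite !addrA -[_ + _ + phi v b]addrA -IH [phi ('X *: a) _ + _]addrC addrK.
Qed.

(** The same exchange with three factors: 1⊗1⊗∂ becomes - ∂⊗1⊗1 - 1⊗∂⊗1. *)
Lemma tensor3_transfer (p : {poly C}) (a b c : R) :
  exists (s : tensor3 R) (t : tensor2 R), forall (W : lmodType C) (phi : R -> R -> R -> W),
    (forall b c, Clinear (fun a => phi a b c)) ->
    (forall a c, Clinear (fun b => phi a b c)) ->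
    (forall a b, Clinear (phi a b)) ->
    phi a b (p *: c) =
    \sum_(u <- tensor3_der s) phi u.1.1 u.1.2 u.2 + \sum_(u <- t) phi u.1 u.2 c.
Proof.
elim/poly_ind: p a b => [|p k IHp] a b.
  exists [::], [::] => W phi phil phim phir.
  by rewrite sum_tensor3_der !big_nil scale0r (Clinear0 (phir a b)) addr0.
have [s1 [t1 st1]] := IHp (- ('X *: a)) b.
have [s2 [t2 st2]] := IHp a (- ('X *: b)).
exists ((a, b, p *: c) :: s1 ++ s2), ((k%:P *: a, b) :: t1 ++ t2) => W phi phil phim phir.
have := st1 W phi phil phim phir; have := st2 W phi phil phim phir.
rewrite !sum_tensor3_der !big_cons !big_cat /=.
rewrite (ClinearN (phil _ _)) (ClinearN (phim _ _)) (ClinearZ (phil b c)).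
rewrite mulrC scalerDl -scalerA (ClinearD (phir a b)) (ClinearZ (phir a b)).
set S1 := \sum_(i <- s1) _; set S2 := \sum_(i <- s2) _ => IH2 IH1.
rewrite [X in _ = X](_ : _ =
  phi ('X *: a) b (p *: c) + phi a ('X *: b) (p *: c) + phi a b ('X *: (p *: c)) +
  (S1 + \sum_(j <- t1) phi j.1 j.2 c) + (S2 + \sum_(j <- t2) phi j.1 j.2 c) +
  k *: phi a b c); last first.
  rewrite -!addrA; congr (_ + (_ + (_ + (_ + _)))).
  by rewrite (AC (1*(1*2)) (3*(1*(4*2)))).
rewrite -IH1 -IH2 [RHS](AC 6 ((1*4)*(2*5)*3*6)).
by rewrite /= !subrr !add0r.
Qed.

Lemma tensor2_reduce (t : tensor2 R) :
  exists (s : tensor2 R) (v : 'I_n -> R), forall (W : lmodType C) (phi : R -> R -> W),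
    (forall b, Clinear (fun a => phi a b)) -> (forall a, Clinear (phi a)) ->
    \sum_(u <- t) phi u.1 u.2 =
    \sum_(u <- tensor2_der s) phi u.1 u.2 + \sum_i phi (v i) (e i).
Proof.
have [sv svP] := choice (fun ui : R * R * 'I_n =>
  tensor2_transfer (d ui.2 ui.1.2) ui.1.1 (e ui.2)).
have {svP} [v svP] := choice svP.
exists (flatten [seq sv (u, i) | u <- t, i <- enum 'I_n]).
exists (fun i => \sum_(u <- t) v (u, i)) => W phi phil phir.
rewrite sum_tensor2_der big_flatten big_allpairs_dep.
under [X in _ = _ + X]eq_bigr do rewrite (Clinear_sum (phil _)).
rewrite [X in _ = _ + X]exchange_big -big_split; apply: eq_bigr => u _ /=.
rewrite big_enum -big_split {1}[u.2](proj1 ed) (Clinear_sum (phir _)).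
apply: eq_bigr => i _.
by rewrite (svP (u, i) W phi phil phir) sum_tensor2_der.
Qed.

Lemma tensor3_reduce (t : tensor3 R) :
  exists (s : tensor3 R) (t' : 'I_n -> tensor2 R),
  forall (W : lmodType C) (phi : R -> R -> R -> W),
    (forall b c, Clinear (fun a => phi a b c)) ->
    (forall a c, Clinear (fun b => phi a b c)) ->
    (forall a b, Clinear (phi a b)) ->
    \sum_(u <- t) phi u.1.1 u.1.2 u.2 =
    \sum_(u <- tensor3_der s) phi u.1.1 u.1.2 u.2
    + \sum_i \sum_(u <- t' i) phi u.1 u.2 (e i).
Proof.
have [st stP] := choice (fun ui : R * R * R * 'I_n =>
  tensor3_transfer (d ui.2 ui.1.2) ui.1.1.1 ui.1.1.2 (e ui.2)).
have {stP} [t' stP] := choice stP.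
exists (flatten [seq st (u, i) | u <- t, i <- enum 'I_n]).
exists (fun i => flatten [seq t' (u, i) | u <- t]) => W phi phil phim phir.
rewrite sum_tensor3_der big_flatten big_allpairs_dep.
under [X in _ = _ + X]eq_bigr do rewrite big_flatten big_map.
rewrite [X in _ = _ + X]exchange_big -big_split; apply: eq_bigr => u _ /=.
rewrite big_enum -big_split {1}[u.2](proj1 ed) (Clinear_sum (phir _ _)).
apply: eq_bigr => i _.
by rewrite (stP (u, i) W phi phil phim phir) sum_tensor3_der.
Qed.

Lemma cdual_der_horner (f : cdual R) (a : R) (x : C) :
  (f ('X *: a)).[x] = x * (f a).[x].
Proof. by rewrite linearZ hornerM hornerX. Qed.

Lemma dual_bases_horner i j (x : C) : (d i (e j)).[x] = (i == j)%:R.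
Proof. by rewrite (proj2 ed); case: (i == j); rewrite !hornerE. Qed.

(** Once the tensor is in the reduced form \sum_i v_i ⊗ e_i, evaluating with
    g = d_i at x gives f(v_i)(-x), so all v_i vanish. *)
Lemma tensor2_der_eval (t : tensor2 R) :
  (exists s, tensor2_eq t (tensor2_der s)) <->
  (forall (f g : cdual R) (x : C), \sum_(u <- t) (f u.1).[- x] * (g u.2).[x] = 0).
Proof.
have phil (f g : cdual R) (x : C) b : Clinear (fun a => (f a).[- x] * (g b).[x] : C^o).
  by move=> c a a'; rewrite cdual_linear !hornerE mulrDl -mulrA.
have phir (f g : cdual R) (x : C) a : Clinear (fun b => (f a).[- x] * (g b).[x] : C^o).
  by move=> c b b'; rewrite cdual_linear !hornerE mulrDr mulrCA.
have der0 s (f g : cdual R) (x : C) :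
    \sum_(u <- tensor2_der s) (f u.1).[- x] * (g u.2).[x] = 0.
  rewrite (sum_tensor2_der (fun a b => (f a).[- x] * (g b).[x])) big1 // => u _ /=.
  by rewrite !cdual_der_horner; ring.
split=> [[s st] f g x | t0].
  by rewrite (st _ _ (phil f g x) (phir f g x)) der0.
have [s [v red]] := tensor2_reduce t.
exists s => W phi phil' phir'; rewrite red // [X in _ + X]big1 ?addr0 // => i _.
rewrite [v i]cdual_separates ?(Clinear0 (phil' _)) // => f.
apply: poly_eq0_horner => x.
have := red _ _ (phil f (d i) (- x)) (phir f (d i) (- x)).
rewrite t0 der0 add0r (bigD1 i) //= dual_bases_horner eqxx mulr1 opprK.
rewrite big1 ?addr0 => [<- //|j ji].
by rewrite dual_bases_horner eq_sym (negPf ji) mulr0.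
Qed.

(** In the reduced form \sum_i t_i ⊗ e_i, taking h = d_i removes the dependence on
    z = - x - y, so the evaluations of t_i at independent x and y all vanish. *)
Lemma tensor3_der_eval (t : tensor3 R) :
  (exists s, tensor3_eq t (tensor3_der s)) <->
  (forall (f g h : cdual R) (x y z : C), x + y + z = 0 ->
     \sum_(u <- t) (f u.1.1).[x] * (g u.1.2).[y] * (h u.2).[z] = 0).
Proof.
pose phi (f g h : cdual R) x y z a b c : C^o := (f a).[x] * (g b).[y] * (h c).[z].
have phil f g h x y z b c : Clinear (fun a => phi f g h x y z a b c).
  by move=> k a a'; rewrite /phi cdual_linear !hornerE !mulrDl -!mulrA.
have phim f g h x y z a c : Clinear (fun b => phi f g h x y z a b c).
  by move=> k b b'; rewrite /phi cdual_linear !hornerE mulrDr mulrDl mulrCA -!mulrA.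
have phir f g h x y z a b : Clinear (phi f g h x y z a b).
  by move=> k c c'; rewrite /phi cdual_linear !hornerE mulrDr mulrCA.
have der0 s (f g h : cdual R) (x y z : C) : x + y + z = 0 ->
    \sum_(u <- tensor3_der s) phi f g h x y z u.1.1 u.1.2 u.2 = 0.
  move=> xyz0; rewrite (sum_tensor3_der (phi f g h x y z)) big1 // => u _.
  rewrite /phi !cdual_der_horner.
  rewrite [LHS](_ : _ = (x + y + z) * phi f g h x y z u.1.1 u.1.2 u.2).
    by rewrite xyz0 mul0r.
  by rewrite /phi; ring.
split=> [[s st] f g h x y z xyz0 | t0].
  apply: etrans (der0 s f g h x y z xyz0).
  exact: (st _ _ (phil f g h x y z) (phim f g h x y z) (phir f g h x y z)).
have [s [t' red]] := tensor3_reduce t.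
exists s => W psi psil psim psir; rewrite red // [X in _ + X]big1 ?addr0 // => i _.
have eval0 : tensor2_eq (t' i) [::]; last first.
  by rewrite (eval0 W (fun a b => psi a b (e i))) ?big_nil.
apply: tensor2_eval0 => f g x y.
have xyz0 : x + y + (- x - y) = 0 by ring.
have := red _ (phi f g (d i) x y (- x - y))
  (phil _ _ _ _ _ _) (phim _ _ _ _ _ _) (phir _ _ _ _ _ _).
rewrite der0 // /phi t0 // add0r (bigD1 i) //=.
under eq_bigr do rewrite dual_bases_horner eqxx mulr1.
rewrite [X in _ + X]big1 ?addr0 => [<- //|j ji].
by rewrite big1 // => u _; rewrite dual_bases_horner eq_sym (negPf ji) mulr0.
Qed.

End Separation.

(** * Sesquilinearity of the bracket under evaluation *)

Section Bracket.
Context {C : numClosedFieldType} {R : lmodType {poly C}}.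

Lemma veval_fsubset (p : vpoly R) (q : {poly C}) (A : {fset nat}) :
  (finsupp p `<=` A)%fset -> veval p q = \sum_(k <- A) q ^+ k *: p k.
Proof.
move=> pA; rewrite /veval (big_fset_incl _ pA) // => k _ kp.
by rewrite fsfun_dflt ?scaler0.
Qed.

Lemma veval_linear (p p1 p2 : vpoly R) (c : {poly C}) (q : {poly C}) :
  (forall k, p k = c *: p1 k + p2 k) -> veval p q = c *: veval p1 q + veval p2 q.
Proof.
move=> pE; pose A := (finsupp p `|` (finsupp p1 `|` finsupp p2))%fset.
rewrite !(@veval_fsubset _ q A); first last.
- exact: fsubsetUl.
- exact: fsubset_trans (fsubsetUl _ _) (fsubsetUr _ _).
- exact: fsubset_trans (fsubsetUr _ _) (fsubsetUr _ _).
rewrite scaler_sumr -big_split; apply: eq_bigr => k _ /=.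
by rewrite pE scalerDr !scalerA mulrC.
Qed.

Lemma cdual_veval (f : cdual R) (p : vpoly R) (q : {poly C}) (x : C) :
  (f (veval p q)).[x] = \sum_(k <- finsupp p) q.[x] ^+ k * (f (p k)).[x].
Proof.
rewrite linear_sum horner_sum; apply: eq_bigr => k _.
by rewrite linearZ hornerM horner_exp.
Qed.

(** A functional turns ∂ into the evaluation point, so the operator q(∂) put for λ
    becomes the scalar q(x). This reduces every substitution to a scalar one. *)
Lemma cdual_veval_horner (f : cdual R) (p : vpoly R) (q : {poly C}) (x : C) :
  (f (veval p q)).[x] = (f (veval p q.[x]%:P)).[x].
Proof. by rewrite !cdual_veval hornerC. Qed.

Context (L : lieConformal R).

Lemma lbr_linl (c : C) (a a' b : R) (q : {poly C}) :
  veval (lbr L (c%:P *: a + a') b) q =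
  c%:P *: veval (lbr L a b) q + veval (lbr L a' b) q.
Proof. by apply: veval_linear => k; apply: lbr_linearl. Qed.

Lemma lbr_linr (c : C) (a b b' : R) (q : {poly C}) :
  veval (lbr L a (c%:P *: b + b')) q =
  c%:P *: veval (lbr L a b) q + veval (lbr L a b') q.
Proof. by apply: veval_linear => k; apply: lbr_linearr. Qed.

Lemma lbrDl (a a' b : R) (q : {poly C}) :
  veval (lbr L (a + a') b) q = veval (lbr L a b) q + veval (lbr L a' b) q.
Proof. by have := lbr_linl 1 a a' b q; rewrite polyC1 !scale1r. Qed.

Lemma lbrDr (a b b' : R) (q : {poly C}) :
  veval (lbr L a (b + b')) q = veval (lbr L a b) q + veval (lbr L a b') q.
Proof. by have := lbr_linr 1 a b b' q; rewrite polyC1 !scale1r. Qed.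

Lemma lbr0l (b : R) (q : {poly C}) : veval (lbr L 0 b) q = 0.
Proof. by apply: (addrI (veval (lbr L 0 b) q)); rewrite -lbrDl !addr0. Qed.

Lemma lbr0r (a : R) (q : {poly C}) : veval (lbr L a 0) q = 0.
Proof. by apply: (addrI (veval (lbr L a 0) q)); rewrite -lbrDr !addr0. Qed.

Lemma lbrNl (a b : R) (q : {poly C}) : veval (lbr L (- a) b) q = - veval (lbr L a b) q.
Proof. by apply: (addrI (veval (lbr L a b) q)); rewrite -lbrDl !subrr lbr0l. Qed.

Lemma lbrNr (a b : R) (q : {poly C}) : veval (lbr L a (- b)) q = - veval (lbr L a b) q.
Proof. by apply: (addrI (veval (lbr L a b) q)); rewrite -lbrDr !subrr lbr0r. Qed.

Lemma lbr_scalel (p : {poly C}) (a b : R) (y : C) :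
  veval (lbr L (p *: a) b) y%:P = p.[- y]%:P *: veval (lbr L a b) y%:P.
Proof.
elim/poly_ind: p a => [|p c IHp] a; first by rewrite horner0 !scale0r lbr0l.
rewrite scalerDl lbrDl -scalerA IHp lbr_derl scalerN scalerA -scaleNr.
have -> : veval (lbr L (c%:P *: a) b) y%:P = c%:P *: veval (lbr L a b) y%:P.
  by rewrite -[c%:P *: a]addr0 lbr_linl lbr0l addr0.
by rewrite -scalerDl hornerMXaddC polyCD polyCM polyCN mulrN.
Qed.

Lemma lbr_scaler (p : {poly C}) (a b : R) (y : C) :
  veval (lbr L a (p *: b)) y%:P = (p \Po ('X + y%:P)) *: veval (lbr L a b) y%:P.
Proof.
elim/poly_ind: p b => [|p c IHp] b; first by rewrite comp_poly0 !scale0r lbr0r.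
rewrite scalerDl lbrDr -scalerA IHp lbr_derr scalerA.
have -> : veval (lbr L a (c%:P *: b)) y%:P = c%:P *: veval (lbr L a b) y%:P.
  by rewrite -[c%:P *: b]addr0 lbr_linr lbr0r addr0.
by rewrite -scalerDl comp_polyD comp_polyM comp_polyX comp_polyC.
Qed.

(** At z the operator - x - ∂ of the skew-symmetry axiom becomes - x - z = y. *)
Lemma cdual_lbr_skew (f : cdual R) (a b : R) (x y z : C) : x + y + z = 0 ->
  (f (veval (lbr L a b) x%:P)).[z] = - (f (veval (lbr L b a) y%:P)).[z].
Proof.
move=> xyz0; have -> : y = - x - z by rewrite -[RHS]addr0 -xyz0; ring.
by rewrite lbr_skew linearN hornerN [in LHS]cdual_veval_horner !hornerE.
Qed.

(** * The Yang-Baxter tensor under evaluation *)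

(** The substitution λ -> -∂ in T^r_0 undoes the twist in the action of ∂ on
    R^{*c}, so linearity holds for every r. *)
Lemma T0_is_linear (r : tensor2 R) : linear (T0 r).
Proof.
move=> p f g; rewrite /T0 /Tmap scaler_sumr -big_split; apply: eq_bigr => u _ /=.
rewrite comp_polyD comp_polyM scalerDl scalerA -comp_polyA.
by rewrite oppr0 sub0r raddfN /= comp_polyX opprK comp_polyXr.
Qed.

Lemma cdual_T0 (r : tensor2 R) (f g : cdual R) (x : C) :
  (f (T0 r g)).[x] = \sum_(u <- r) (g u.1).[- x] * (f u.2).[x].
Proof.
rewrite linear_sum horner_sum; apply: eq_bigr => u _.
by rewrite linearZ hornerM horner_comp !hornerE oppr0 sub0r.
Qed.

Lemma cdual_T0_flip (r : tensor2 R) (f g : cdual R) (x : C) :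
  (f (T0 (tensor2_flip r) g)).[x] = (g (T0 r f)).[- x].
Proof.
rewrite !cdual_T0 big_map; apply: eq_bigr => u _ /=.
by rewrite opprK mulrC.
Qed.

(** The coefficient g(a_i)(-∂) of the first argument leaves the bracket as
    g(a_i)(y), and h(a_j)(-∂) leaves the second as h(a_j)(-∂-y), which f evaluates
    at ∂ = x, that is, as h(a_j)(z). *)
Lemma cdual_lbr_T0 (s t : tensor2 R) (f g h : cdual R) (x y z : C) :
  x + y + z = 0 ->
  (f (veval (lbr L (T0 s g) (T0 t h)) y%:P)).[x] =
  \sum_(u <- s) \sum_(v <- t)
    (g u.1).[y] * (h v.1).[z] * (f (veval (lbr L u.2 v.2) y%:P)).[x].
Proof.
move=> xyz0; rewrite (big_morph (fun a => veval (lbr L a _) _)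
  (fun a a' => lbrDl a a' _ _) (lbr0l _ _)) linear_sum horner_sum.
apply: eq_bigr => u _; rewrite lbr_scalel.
rewrite (big_morph (fun b => veval (lbr L _ b) _)
  (fun b b' => lbrDr _ b b' _) (lbr0r _ _)) scaler_sumr linear_sum horner_sum.
apply: eq_bigr => v _; rewrite lbr_scaler scalerA linearZ !hornerM hornerC.
rewrite !horner_comp !hornerE oppr0 !sub0r opprK.
by rewrite -[z](addKr (x + y)) xyz0 addr0.
Qed.

Lemma cybe_eval (r : tensor2 R) (f g h : cdual R) (x y z : C) :
  x + y + z = 0 ->
  \sum_(u <- cybe1 L r ++ tensor3_opp (cybe2 L r) ++ tensor3_opp (cybe3 L r))
    (f u.1.1).[x] * (g u.1.2).[y] * (h u.2).[z] =
  (f (veval (lbr L (T0 (tensor2_flip r) g) (T0 (tensor2_flip r) h)) y%:P)).[x]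
  - (g (veval (lbr L (T0 (tensor2_flip r) h) (T0 r f)) z%:P)).[y]
  - (h (veval (lbr L (T0 r g) (T0 r f)) y%:P)).[z].
Proof.
move=> xyz0; rewrite !big_cat /= !big_map.
have yzx0 : y + z + x = 0 by rewrite -xyz0; ring.
have zyx0 : z + y + x = 0 by rewrite -xyz0; ring.
rewrite (cdual_lbr_T0 _ _ _ _ _ xyz0) (cdual_lbr_T0 _ _ _ _ _ yzx0).
rewrite (cdual_lbr_T0 _ _ _ _ _ zyx0).
rewrite -!addrA; congr (_ + (_ + _)).
- rewrite /tensor2_flip big_map big_flatten big_allpairs_dep; apply: eq_bigr => u _.
  rewrite big_map; apply: eq_bigr => v _; rewrite big_map cdual_veval mulr_sumr.
  apply: eq_bigr => k _ /=.
  by rewrite linearZ hornerM hornerXn hornerC; ring.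
- rewrite /tensor2_flip big_map big_flatten big_allpairs_dep exchange_big -sumrN.
  apply: eq_bigr => u _; rewrite -sumrN; apply: eq_bigr => v _ /=.
  rewrite big_map cdual_veval mulr_sumr -sumrN; apply: eq_bigr => k _ /=.
  by rewrite !linearN linearZ !hornerE /=; ring.
- rewrite big_flatten big_allpairs_dep exchange_big -sumrN.
  apply: eq_bigr => u _; rewrite -sumrN; apply: eq_bigr => v _ /=.
  rewrite big_map cdual_veval mulr_sumr -sumrN; apply: eq_bigr => k _ /=.
  by rewrite !linearN linearZ !hornerE /=; ring.
Qed.

End Bracket.

(** * Skew-symmetry, the Yang-Baxter equation and cocycles *)

Lemma tensor2_skewW (C : numClosedFieldType) (R : lmodType {poly C}) (r : tensor2 R) :
  tensor2_skew r -> tensor2_skew_mod r.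
Proof.
move=> skew; exists [::] => W phi phil phir.
rewrite /= big_nil big_cat /= (skew W phi phil phir) /tensor2_opp big_map -big_split.
by rewrite big1 // => u _ /=; rewrite (ClinearN (phil _)) addNr.
Qed.

Section Cocycle.
Context {C : numClosedFieldType} {R : lmodType {poly C}} (L : lieConformal R).
Context (n : nat) (e : 'I_n -> R) (d : 'I_n -> cdual R).
Context (ed : dual_bases e d).

(** The number f(T g)(x) + g(T f)(-x) is the evaluation of r + r^{21} at g ⊗ f and
    (-x, x), and these evaluations detect the image of ∂⊗1 + 1⊗∂. With f = S(b)
    and g = S(a), for S inverse to T, the condition is the skew-symmetry of the
    form alpha. *)
Lemma tensor2_skew_modP (r : tensor2 R) :
  tensor2_skew_mod r <->
  forall (f g : cdual R) (x : C), (f (T0 r g)).[x] = - (g (T0 r f)).[- x].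
Proof.
rewrite /tensor2_skew_mod (tensor2_der_eval ed); split=> skew f g x.
  apply/eqP; rewrite -addr_eq0 -cdual_T0_flip !cdual_T0 -big_cat.
  by rewrite skew.
by rewrite big_cat -!cdual_T0 /= cdual_T0_flip skew addNr.
Qed.

(** The sum on the right is the defect in the cocycle identity for
    (T f, T g, T h), with the last term moved to the functional h by
    skew-symmetry. *)
Lemma conformal_CYBEP (r : tensor2 R) :
  tensor2_skew_mod r ->
  conformal_CYBE L r <->
  forall (f g h : cdual R) (x y : C),
    (f (veval (lbr L (T0 r g) (T0 r h)) y%:P)).[x]
    - (g (veval (lbr L (T0 r f) (T0 r h)) x%:P)).[y]
    + (h (veval (lbr L (T0 r f) (T0 r g)) x%:P)).[- (x + y)] = 0.
Proof.
move=> /tensor2_skew_modP skew.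
have flipE g : T0 (tensor2_flip r) g = - T0 r g.
  apply/eqP; rewrite -addr_eq0; apply/eqP/(cdual_separates ed) => f.
  apply: poly_eq0_horner => x.
  by rewrite linearD hornerD cdual_T0_flip skew opprK addNr.
have evalE (f g h : cdual R) (x y z : C) : x + y + z = 0 ->
    \sum_(u <- cybe1 L r ++ tensor3_opp (cybe2 L r) ++ tensor3_opp (cybe3 L r))
      (f u.1.1).[x] * (g u.1.2).[y] * (h u.2).[z] =
    (f (veval (lbr L (T0 r g) (T0 r h)) y%:P)).[x]
    - (g (veval (lbr L (T0 r f) (T0 r h)) x%:P)).[y]
    + (h (veval (lbr L (T0 r f) (T0 r g)) x%:P)).[z].
  move=> xyz0; rewrite cybe_eval // !flipE !(lbrNl, lbrNr) opprK.
  rewrite linearN hornerN opprK.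
  rewrite (@cdual_lbr_skew _ _ L g _ _ z x y); last by rewrite -xyz0; ring.
  rewrite (@cdual_lbr_skew _ _ L h _ _ y x z); last by rewrite -xyz0; ring.
  by rewrite opprK.
rewrite /conformal_CYBE (tensor3_der_eval ed); split=> cybe f g h x y.
  have xyz0 : x + y + (- (x + y)) = 0 by rewrite subrr.
  by rewrite -evalE // cybe.
by move=> z xyz0; rewrite evalE // -(cybe f g h x y) -[z](addKr (x + y)) xyz0 addr0.
Qed.

Lemma skew_CYBE_cocycle (r : tensor2 R) :
  tensor2_skew_mod r /\ tensor2_nondegenerate r /\ conformal_CYBE L r <->
  inverse_form_cocycle L r.
Proof.
split=> [[skew [[_ [S TK SK]] /(conformal_CYBEP skew) cybe]] | [S [TK SK cocycle]]].
  have Slin p a b : S (p *: a + b) = p *: S a + S b.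
    by apply: (can_inj TK); rewrite T0_is_linear !SK.
  have /tensor2_skew_modP skewE := skew.
  exists S; split=> //; split=> [c a a' b|c a b b'|a b|a b|a b|a b c x y].
  - by rewrite Slin /= comp_polyC mul_polyC.
  - by rewrite cdual_linear mul_polyC.
  - have S0 : S 0 = 0 by rewrite -[RHS](addNr (S 0)) -scaleN1r -Slin scaler0 addr0.
    by rewrite -[_ *: a]addr0 Slin S0 addr0 cdual_derE.
  - exact: cdual_der.
  - apply: poly_eq_horner => x; rewrite hornerN horner_comp !hornerE.
    by rewrite -{1}[b]SK -{2}[a]SK skewE.
  - have := cybe (S a) (S b) (S c) x y; rewrite !SK => /eqP; rewrite addr_eq0 => /eqP ->.
    (* Skewness moves [a _x b] from argument of S c to argument of S. *)
    by rewrite -[X in S c X]SK skewE !SK !opprK.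
have skew : tensor2_skew_mod r.
  apply/tensor2_skew_modP => f g x.
  have := cocycle_skew cocycle (T0 r f) (T0 r g); rewrite !TK => ->.
  by rewrite hornerN horner_comp !hornerE.
split=> //; split; first by split; [exact: T0_is_linear | exists S].
apply/conformal_CYBEP => // f g h x y.
have /tensor2_skew_modP skewE := skew.
have := cocycle_jacobi cocycle (T0 r f) (T0 r g) (T0 r h) x y; rewrite !TK => ->.
by rewrite -[X in h X]SK skewE addNr.
Qed.

End Cocycle.

Theorem theorem3p12 (K : realType) (R : lmodType {poly complex K})
    (L : lieConformal R) (hfin : finite_module R) (hfree : free_module R)
    (r : tensor2 R) :
  (tensor2_skew r ->
     (tensor2_nondegenerate r /\ conformal_CYBE L r <-> inverse_form_cocycle L r)) /\
  (tensor2_skew_mod r /\ tensor2_nondegenerate r /\ conformal_CYBE L r <->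
     inverse_form_cocycle L r).
Proof.
have [n [e [d ed]]] := finite_free_dual_bases hfin hfree.
have key := skew_CYBE_cocycle L ed r.
split=> // /tensor2_skewW skew; rewrite -key.
by split=> [//|[_ //]].
Qed.
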